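(* Let $f=4/5$, $d_1=3/5$, $d_3=1/10$, $d_1^1+d_3^1=15/100$. Under the two-step construction described in the context, these values uniquely determine the values $d_1^1,d_3^1,d_1^2,d_3^2,d_2^1,d_1^3,d_2^2,d_3^3,d_1^4,d_3^4,d_1^5$. Let $\delta^1,\delta^2>0$ be any rational numbers such that $\delta^1+\delta^2<d_1^2+d_2^2$ and, as the construction requires, $\delta^1+\delta^2<d_2^1/2$, and let $\pi$ be the function given by these parameters and the construction. Then $\pi$ is not extreme for $R_f(\mathbb{R},\mathbb{Z})$.
   Context: Group problem. $R_f(\mathbb{R},\mathbb{Z})$ is the convex hull of the set of all functions $s\colon\mathbb{R}\to\mathbb{Z}_+$ of finite support with $\sum_{r} r\,s(r)\in f+\mathbb{Z}$. A valid function is a function $\pi\colon\mathbb{R}\to\mathbb{R}$ with $\pi\ge0$ and $\sum_r\pi(r)s(r)\ge1$ for all $s\in R_f(\mathbb{R},\mathbb{Z})$. A valid function $\pi$ is extreme if $\pi=\frac12(\pi^1+\pi^2)$ with $\pi^1,\pi^2$ valid implies $\pi=\pi^1=\pi^2$. Construction (superscripts are indices; $d^i_j$ is the length of the $i$-th interval on which the slope is $c_j$). Step 1. Given $f\in(0,1)$ and lengths $d_1,d_2,d_3>0$ with $d_1+d_2+d_3=f$, set $c_2=0$, $c_3=-\frac1{1-f}$, $c_1=\frac{1-d_2c_2-d_3c_3}{d_1}$. The positive numbers $d^i_j$ are required to satisfy $d_1^1+d_1^2+d_1^3+d_1^4+d_1^5=d_1$, $d_2^1+d_2^2=d_2$,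 $d_3^1+d_3^2+d_3^3+d_3^4=d_3$; the symmetry conditions $d_1^1=d_1^5$, $d_1^2=d_1^4$, $d_2^1=d_2^2$, $d_3^1=d_3^4$, $d_3^2=d_3^3$; the conditions $d_1^1+d_3^1=d_2^1+d_1^3$ and $d_1^1c_1+d_3^1c_3=d_2^1c_2+d_1^3c_1$; and the prescribed value of $d_1^1+d_3^1$. Step 2. Given $\delta^1,\delta^2>0$ with $\delta^1+\delta^2<d_2^1/2$, let $\delta^i_1,\delta^i_3$ ($i=1,2$) be determined by $\delta^i_1+\delta^i_3=\delta^i$ and $c_1\delta^i_1+c_3\delta^i_3=0$. Put $\tilde d_1^2=d_1^2-\delta_1^1-\delta_1^2$, $\tilde d_1^4=d_1^4-\delta_1^1-\delta_1^2$, $\tilde d_3^2=d_3^2-\delta_3^1-\delta_3^2$, $\tilde d_3^3=d_3^3-\delta_3^1-\delta_3^2$, $e_3=1-f$. The function $\pi$ is the continuous function, periodic modulo $\mathbb{Z}$, with $\pi(0)=0$, that is piecewise linear on $[0,1]$ with consecutive intervals (from left to right, starting at $0$) of lengths $$d_1^1,\ d_3^1,\ \delta_1^1,\ \delta_3^1,\ \delta_1^2,\ \delta_3^2,\ \tilde d_1^2,\ \tilde d_3^2,\ d_2^1,\ d_1^3,\ d_2^2,\ \tilde d_3^3,\ \tilde d_1^4,\ \delta_3^2,\ \delta_1^2,\ \delta_3^1,\ \delta_1^1,\ d_3^4,\ d_1^5,\ e_3,$$ the slope on each interval being $c_j$, where $j$ is the subscript of the corresponding length. *)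

(* Defs.v *)
From mathcomp Require Export all_boot all_order all_algebra.
From mathcomp Require Export all_classical all_reals all_analysis.

Set Implicit Arguments.
Unset Strict Implicit.
Unset Printing Implicit Defensive.

Import Order.TTheory GRing.Theory Num.Theory.

Local Open Scope classical_set_scope.
Local Open Scope ring_scope.

(** * The infinite group problem *)

(* [R -> R^o] rather than [R -> R]: [R^o] makes the function space an
   [lmodType R], hence a convex space. *)
Definition group_solution (R : realType) (f : R) : set (R -> R^o) :=
  [set s | [/\ forall r, exists n : nat, s r = n%:R,
               finite_set [set r | s r != 0] &
               exists z : int, \sum_(r \in [set: R]) r * s r = f + z%:~R]].

Definition convex_hull (R : realType) (V : lmodType R) (A : set V) : set V :=
  smallest (@convex_set R V) A.

Definition group_relaxation (R : realType) (f : R) : set (R -> R^o) :=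
  convex_hull (group_solution f).

(* Every [s] in the convex hull has finite support, so the sum is finite. *)
Definition valid (R : realType) (f : R) (pi : R -> R) : Prop :=
  (forall r, 0 <= pi r) /\
  forall s, group_relaxation f s -> 1 <= \sum_(r \in [set: R]) pi r * s r.

Definition extreme (R : realType) (f : R) (pi : R -> R) : Prop :=
  valid f pi /\
  forall pi1 pi2 : R -> R, valid f pi1 -> valid f pi2 ->
    (forall r, pi r = 2^-1 * (pi1 r + pi2 r)) -> pi = pi1 /\ pi = pi2.

(** * The construction *)

Definition slope2 (R : realType) : R := 0.

Definition slope3 (R : realType) (f : R) : R := - (1 - f)^-1.

Definition slope1 (R : realType) (f d1 d2 d3 : R) : R :=
  (1 - d2 * slope2 R - d3 * slope3 f) / d1.

(* [dj_i] stands for $d_j^i$: subscript first, superscript second. *)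
Record lengths (R : realType) := Lengths {
  d1_1 : R; d3_1 : R; d1_2 : R; d3_2 : R; d2_1 : R; d1_3 : R;
  d2_2 : R; d3_3 : R; d1_4 : R; d3_4 : R; d1_5 : R }.

(* [a] is the prescribed value of $d_1^1 + d_3^1$. *)
Record step1 (R : realType) (f d1 d2 d3 a : R) (d : lengths R) : Prop := Step1 {
  f_range : 0 < f < 1;
  total_pos : [/\ 0 < d1, 0 < d2 & 0 < d3];
  total_sum : d1 + d2 + d3 = f;
  pos1 : [/\ 0 < d1_1 d, 0 < d1_2 d, 0 < d1_3 d, 0 < d1_4 d & 0 < d1_5 d];
  pos2 : 0 < d2_1 d /\ 0 < d2_2 d;
  pos3 : [/\ 0 < d3_1 d, 0 < d3_2 d, 0 < d3_3 d & 0 < d3_4 d];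
  sum1 : d1_1 d + d1_2 d + d1_3 d + d1_4 d + d1_5 d = d1;
  sum2 : d2_1 d + d2_2 d = d2;
  sum3 : d3_1 d + d3_2 d + d3_3 d + d3_4 d = d3;
  sym1 : d1_1 d = d1_5 d /\ d1_2 d = d1_4 d;
  sym2 : d2_1 d = d2_2 d;
  sym3 : d3_1 d = d3_4 d /\ d3_2 d = d3_3 d;
  balance_length : d1_1 d + d3_1 d = d2_1 d + d1_3 d;
  balance_rise :
    d1_1 d * slope1 f d1 d2 d3 + d3_1 d * slope3 f =
    d2_1 d * slope2 R + d1_3 d * slope1 f d1 d2 d3;
  prescribed : d1_1 d + d3_1 d = a }.

(* [x] and [y] are the lengths $\delta_1$, $\delta_3$ obtained from $\delta$. *)
Definition delta_split (R : realType) (c1 c3 delta x y : R) : Prop :=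
  x + y = delta /\ c1 * x + c3 * y = 0.

(* The continuous function on $[0, +\infty)$ vanishing at 0, with slope [p.2]
   on consecutive intervals of length [p.1] for [p] in [l], and constant after
   the last one. *)
Fixpoint pwl (R : realType) (l : seq (R * R)) (x : R) : R :=
  if l is (len, slope) :: l' then
    if x <= len then slope * x else slope * len + pwl l' (x - len)
  else 0.

(* [xi], [yi] stand for $\delta_1^i$, $\delta_3^i$. *)
Definition pieces (R : realType) (f c1 c2 c3 : R) (d : lengths R)
    (x1 y1 x2 y2 : R) : seq (R * R) :=
  [:: (d1_1 d, c1); (d3_1 d, c3);
      (x1, c1); (y1, c3); (x2, c1); (y2, c3);
      (d1_2 d - x1 - x2, c1); (d3_2 d - y1 - y2, c3);
      (d2_1 d, c2); (d1_3 d, c1); (d2_2 d, c2);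
      (d3_3 d - y1 - y2, c3); (d1_4 d - x1 - x2, c1);
      (y2, c3); (x2, c1); (y1, c3); (x1, c1);
      (d3_4 d, c3); (d1_5 d, c1); (1 - f, c3)].

(* The lengths of the pieces sum to 1 and, by the choice of the slopes, the
   total rise over [0, 1] is 0; evaluating at the fractional part of [r]
   therefore yields the continuous 1-periodic extension. *)
Definition construction (R : realType) (f d1 d2 d3 : R) (d : lengths R)
    (x1 y1 x2 y2 : R) : R -> R :=
  fun r => pwl (pieces f (slope1 f d1 d2 d3) (slope2 R) (slope3 f) d
                       x1 y1 x2 y2)
               (r - (Num.floor r)%:~R).

(* Main.v *)
Require Import Defs.
From mathcomp Require Import finmap ring lra zify.

(** The construction only has the slopes 5/2, 0 and -5, and it is constant
    exactly on the two plateaus [3/10, 7/20] and [9/20, 1/2], modulo 1, where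
    its values are 3/8 and 5/8. As the parameters are rational, all breakpoints
    lie on a common grid (1/N)Z. The perturbation is a small wave that lives on
    the plateaus only: on each grid cell of a plateau it is the piecewise linear
    function with values 0, e, -e, 0 at the multiples of 1/(3N), and it is 0 on
    all other cells. It remains to see that [pi] plus or minus this wave is
    valid when e > 0 is small.

    A valid function with [pi x + pi (f - x) = 1] is automatically subadditive
    ([valid_symmetric_subadditive]), because the solution with columns [x], [y]
    and [f - x - y] costs at least 1; conversely a nonnegative subadditive
    function vanishing at 0, with value 1 on [f + Z], is valid
    ([valid_of_subadditive]). So if [pi] is valid, which extremality includes,
    then it is subadditive, and the subadditivity of the perturbed functions is
    what has to be proved. Both functions are interpolated from the grid
    (1/(3N))Z, and interpolation preserves subadditivity
    ([interp_subadditive]), so finitely many inequalities matter up to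
    periodicity. The strict ones survive a small perturbation; hence it is
    enough that the wave is additive on each pair of grid points where [pi] is
    ([grid_perturbation_not_extreme]).

    That is a matter of slopes ([flat_wave_additive]). Suppose that [pi] is
    additive at a pair [(x, y)] of points of the fine grid. The defect
    [pi x + pi y - pi (x + y)] is affine on the triangle or edge of the coarse
    subdivision of the plane having [(x, y)] in its interior, and nonnegative at
    the vertices; so it vanishes there identically. At coarse grid points the
    wave is 0. On an edge the vanishing equates the slopes of two of the cells
    of [x], [y], [x + y], so both are flat or neither is, and the wave is
    additive along the edge: it is the same on any two flat cells, and odd about
    their midpoints. On a triangle all three slopes are equal, and they cannot all be 0, since the sum of two plateau
    heights is at least 3/4, above 5/8; thus the wave vanishes on all three
    cells. *)

Set Implicit Arguments.
Unset Strict Implicit.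
Unset Printing Implicit Defensive.

Import Order.TTheory GRing.Theory Num.Theory.

Local Open Scope classical_set_scope.
Local Open Scope ring_scope.

(** * Validity and subadditivity *)

Definition subadditive (U : nmodType) (R : realType) (F : U -> R) : Prop :=
  forall x y, F (x + y) <= F x + F y.

Section Validity.
Variable R : realType.
Implicit Types (f x y z : R) (F : R -> R) (s : R -> R^o).

Lemma fsum_mul_support F s (A : {fset R}) :
    (forall r, s r != 0 -> r \in A) ->
  \sum_(r \in [set: R]) F r * s r = \sum_(r <- A) F r * s r.
Proof.
move=> sA; apply: fsbigTE => r rA.
have [->|/sA] := eqVneq (s r) 0; first by rewrite mulr0.
by rewrite (negbTE rA).
Qed.

Lemma subadditive_sum F (A : seq R) (n : R -> nat) :
    F 0 = 0 -> subadditive F ->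
  F (\sum_(r <- A) r * (n r)%:R) <= \sum_(r <- A) F r * (n r)%:R.
Proof.
move=> F0 Fsub.
have Fmuln r k : F (r * k%:R) <= F r * k%:R.
  elim: k => [|k IHk]; first by rewrite !mulr0 F0.
  rewrite -natr1 !mulrDr !mulr1.
  by apply: (le_trans (Fsub _ _)); rewrite lerD2r.
elim: A => [|r A IHA]; first by rewrite !big_nil F0.
rewrite !big_cons; apply: (le_trans (Fsub _ _)).
exact: lerD (Fmuln _ _) IHA.
Qed.

(** A linear inequality passes from the integer solutions to their convex hull.
    The finiteness of the support has to be carried along, since the sum of a
    function of infinite support is 0 by convention. *)
Lemma group_relaxation_ge1 f F :
    (forall s, group_solution f s -> 1 <= \sum_(r \in [set: R]) F r * s r) ->
  forall s, group_relaxation f s -> 1 <= \sum_(r \in [set: R]) F r * s r.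
Proof.
move=> Fsol.
pose H : set (R -> R^o) := [set s | finite_set [set r | s r != 0] /\
  1 <= \sum_(r \in [set: R]) F r * s r].
suff HH : group_relaxation f `<=` H by move=> s /HH[].
apply: smallest_sub; last first.
  by move=> s fs; split; [case: fs|apply: Fsol].
move=> s1 s2 t /set_mem[fin1 ge1] /set_mem[fin2 ge2]; apply: mem_set.
pose A := (fset_set [set r | s1 r != 0%R] `|` fset_set [set r | s2 r != 0%R])%fset.
have A1 r : s1 r != 0 -> r \in A.
  by move=> h; rewrite in_fsetU in_fset_set // mem_set.
have A2 r : s2 r != 0 -> r \in A.
  by move=> h; rewrite in_fsetU [X in _ || X]in_fset_set // [X in _ || X]mem_set ?orbT.
have convE r : (conv t (s1 : convex_lmodType (R -> R^o)) s2 : R -> R^o) r =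
    t%:num * s1 r + (1 - t%:num) * s2 r by [].
have A3 r : (conv t (s1 : convex_lmodType (R -> R^o)) s2 : R -> R^o) r != 0 ->
    r \in A.
  rewrite convE; have [s10|/A1//] := eqVneq (s1 r) 0.
  have [s20|/A2//] := eqVneq (s2 r) 0.
  by rewrite s10 s20 !mulr0 addr0 eqxx.
split.
  by apply: (@sub_finite_set _ _ [set` A]) => [r /A3//|]; exact: finite_fset.
rewrite (fsum_mul_support F A3).
move: ge1 ge2; rewrite (fsum_mul_support F A1) (fsum_mul_support F A2).
under [X in _ -> _ -> _ <= X]eq_bigr do
  rewrite convE mulrDr mulrCA [X in _ + X]mulrCA.
rewrite big_split /= -!mulr_sumr => ge1 ge2.
have t0 : 0 <= t%:num by [].
have t1 : t%:num <= 1 by [].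
nra.
Qed.

Lemma valid_of_subadditive f F :
    F 0 = 0 -> subadditive F -> (forall x, 0 <= F x) ->
    (forall z : int, 1 <= F (f + z%:~R)) ->
  valid f F.
Proof.
move=> F0 Fsub Fge0 Ff; split=> //.
apply: group_relaxation_ge1 => s [snat sfin [z sE]].
pose A := fset_set [set r | s r != 0%R].
have sA r : s r != 0 -> r \in A by move=> h; rewrite in_fset_set // mem_set.
have [n nE] := choice snat.
move: sE; rewrite !(fsum_mul_support _ sA).
under eq_bigr do rewrite nE; under [X in _ -> _ <= X]eq_bigr do rewrite nE.
move=> sE; apply: le_trans (subadditive_sum A n F0 Fsub).
by rewrite sE.
Qed.

Lemma valid_sum3_ge1 f F x y z : valid f F -> x + y + z = f ->
  1 <= F x + F y + F z.
Proof.
move=> [_ Fv] xyz.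
pose s : R -> R^o := fun r => ((r == x) + (r == y) + (r == z))%N%:R.
pose A := [fset x; y; z]%fset.
have sA r : s r != 0 -> r \in A.
  rewrite /s !inE; case: (r == x); case: (r == y); case: (r == z) => //=.
  by rewrite eqxx.
have sumE G : \sum_(r \in [set: R]) G r * s r = G x + G y + G z.
  rewrite (fsum_mul_support _ sA).
  have pick w : w \in A -> \sum_(r <- A) G r * (r == w)%:R = G w.
    move=> wA; rewrite (bigD1_seq w) //= eqxx mulr1 big1 ?addr0 // => r.
    by move/negbTE->; rewrite mulr0.
  under eq_bigr do rewrite /s !natrD !mulrDr.
  by rewrite !big_split /= !pick // !inE eqxx ?orbT.
rewrite -sumE; apply: Fv; apply: sub_gen_smallest; split.
- by move=> r; eexists.
- by apply: (@sub_finite_set _ _ [set` A]) => [r /sA//|]; exact: finite_fset.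
- by exists 0; rewrite (sumE id) addr0.
Qed.

(** Apply validity to the solution with columns [x], [y] and [f - (x + y)], and
    use symmetry to turn [F (f - (x + y))] into [1 - F (x + y)]. *)
Lemma valid_symmetric_subadditive f F :
  valid f F -> (forall x, F x + F (f - x) = 1) -> subadditive F.
Proof.
move=> Fv Fsym x y.
have sumf : x + y + (f - (x + y)) = f by rewrite addrC subrK.
have := valid_sum3_ge1 Fv sumf; have := Fsym (x + y); lra.
Qed.

End Validity.

(** * Interpolation from a regular grid *)

Section Interpolation.
Variables (R : realType) (M : nat).
Hypothesis M_gt0 : (0 < M)%N.
Implicit Types (g h : int -> R) (k i j : int) (t u x y : R) (F : R -> R).

Definition interp g x : R :=
  let k := Num.floor (x * M%:R) in
  let t := x * M%:R - k%:~R in (1 - t) * g k + t * g (k + 1).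

Let M0 : M%:R != 0 :> R. Proof. by rewrite pnatr_eq0 -lt0n. Qed.

Lemma grid_cell x : exists k t, 0 <= t < 1 /\ x = (k%:~R + t) / M%:R.
Proof.
exists (Num.floor (x * M%:R)), (x * M%:R - (Num.floor (x * M%:R))%:~R).
split; last by rewrite addrC subrK mulfK.
by have := floor_itv (x * M%:R); rewrite intrD; lra.
Qed.

Lemma interp_cell g k t : 0 <= t <= 1 ->
  interp g ((k%:~R + t) / M%:R) = (1 - t) * g k + t * g (k + 1).
Proof.
move=> /andP[t0]; rewrite /interp divfK // le_eqVlt => /orP[/eqP->|t1].
  have -> : Num.floor (k%:~R + 1 : R) = k + 1.
    by apply: floor_def; rewrite !intrD; lra.
  by rewrite !intrD; ring.
have -> : Num.floor (k%:~R + t : R) = k.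
  by apply: floor_def; rewrite !intrD; lra.
ring.
Qed.

Lemma interp_grid g k : interp g (k%:~R / M%:R) = g k.
Proof. by rewrite -[k%:~R]addr0 interp_cell ?lexx ?ler01 //; ring. Qed.

Definition grid_affine F : Prop := forall k t, 0 <= t <= 1 ->
  F ((k%:~R + t) / M%:R) =
    (1 - t) * F (k%:~R / M%:R) + t * F ((k + 1)%:~R / M%:R).

(** Being affine on the grid cells is what allows [F] to be replaced by the
    integer-indexed family of its grid values. *)
Lemma grid_affine_interp F : grid_affine F ->
  F =1 interp (fun k => F (k%:~R / M%:R)).
Proof.
move=> FM x; have [k [t [/andP[t0 t1] ->]]] := grid_cell x.
by rewrite interp_cell ?FM // t0 ltW.
Qed.

(** On the cell product of [x] and [y], cut by the line where [x + y] meets the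
    grid, [F x + F y - F (x + y)] is affine on each of the two triangles. It is
    therefore a convex combination of its values at the vertices, which are grid
    pairs. *)
Lemma interp_subadditive g : subadditive g -> subadditive (interp g).
Proof.
move=> gsub x y.
have [a [t [/andP[t0 t1] ->]]] := grid_cell x.
have [b [u [/andP[u0 u1] ->]]] := grid_cell y.
rewrite -mulrDl !interp_cell ?t0 ?u0 ?(ltW t1) ?(ltW u1) //.
have h10 : g (a + b + 1) <= g (a + 1) + g b by rewrite addrAC gsub.
have h01 : g (a + b + 1) <= g a + g (b + 1) by rewrite -addrA gsub.
have [tu|tu] := leP (t + u) 1.
  have -> : a%:~R + t + (b%:~R + u) = (a + b)%:~R + (t + u) :> R.
    by rewrite intrD; ring.
  rewrite interp_cell; last by rewrite addr_ge0.
  have h00 : g (a + b) <= g a + g b by exact: gsub.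
  have := ler_wpM2l t0 h10; have := ler_wpM2l u0 h01.
  have /ler_wpM2l/(_ _ _ h00) : 0 <= 1 - (t + u) by rewrite subr_ge0.
  by move=> *; lra.
have -> : a%:~R + t + (b%:~R + u) = (a + b + 1)%:~R + (t + u - 1) :> R.
  by rewrite !intrD; ring.
rewrite interp_cell; last by lra.
have h11 : g (a + b + 1 + 1) <= g (a + 1) + g (b + 1).
  by rewrite -addrA addrACA gsub.
have /ler_wpM2l/(_ _ _ h11) : 0 <= t + u - 1 by lra.
have /ler_wpM2l/(_ _ _ h10) : 0 <= 1 - u by lra.
have /ler_wpM2l/(_ _ _ h01) : 0 <= 1 - t by lra.
lra.
Qed.

Lemma periodic_modz g : (forall k, g (k + M) = g k) ->
  forall k, g (k %% M)%Z = g k.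
Proof.
move=> gM.
have gMn (n : nat) k : g (k + n%:Z * M) = g k.
  elim: n k => [|n IHn] k; first by rewrite mul0r addr0.
  by rewrite intS mulrDl mul1r addrA IHn gM.
move=> k; rewrite {2}(divz_eq k M) addrC.
case: (k %/ M)%Z => n; first by rewrite gMn.
by rewrite -[RHS](gMn n.+1) -addrA -mulrDl NegzE addNr mul0r addr0.
Qed.

(** [0 = g (k * M) <= M * g k]. *)
Lemma subadditive_periodic_ge0 g : g 0 = 0 -> subadditive g ->
  (forall k, g (k + M) = g k) -> forall k, 0 <= g k.
Proof.
move=> g0 gsub gM k.
have gmul (n : nat) : g (k * n%:Z) <= g k * n%:R.
  elim: n => [|n IHn]; first by rewrite !mulr0 g0.
  rewrite -natr1 intS addrC !mulrDr !mulr1.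
  by apply: (le_trans (gsub _ _)); rewrite lerD2r.
have := gmul M; rewrite -periodic_modz // modzMl g0.
by rewrite pmulr_lge0 // ltr0n.
Qed.

Lemma interp_ge0 g : (forall k, 0 <= g k) -> forall x, 0 <= interp g x.
Proof.
move=> g0 x; have [k [t [/andP[t0 t1] ->]]] := grid_cell x.
rewrite interp_cell ?t0 ?(ltW t1) //.
by rewrite addr_ge0 // mulr_ge0 // subr_ge0 ltW.
Qed.

Lemma interp_valid f (F : int) g : f = F%:~R / M%:R ->
    g 0 = 0 -> g F = 1 -> subadditive g -> (forall k, g (k + M) = g k) ->
  valid f (interp g).
Proof.
move=> fE g0 gF gsub gM; apply: valid_of_subadditive.
- by rewrite -[0 in LHS](mul0r M%:R^-1) -[0 in LHS]/(0%:~R) interp_grid.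
- exact: interp_subadditive.
- by apply: interp_ge0 => k; exact: subadditive_periodic_ge0.
move=> z; have -> : f + z%:~R = (F + z * M)%:~R / M%:R.
  by rewrite intrD intrM fE; field.
by rewrite interp_grid -periodic_modz // addrC modzMDl periodic_modz // gF.
Qed.

End Interpolation.

(** * Perturbations on a grid and on flat cells *)

(** Finitely many nonnegative margins [a x] leave room for a common multiple of
    the perturbations [b x], provided that [b] vanishes where there is no room. *)
Lemma finite_margin (R : realType) (T : finType) (a b : T -> R) :
    (forall x, 0 <= a x) -> (forall x, a x = 0 -> b x = 0) ->
  exists2 e, 0 < e & forall x, e * `|b x| <= a x.
Proof.
move=> a_ge0 ab0; pose S := \sum_x `|b x| / a x.
have term_ge0 x : 0 <= `|b x| / a x by rewrite divr_ge0.
have S_ge0 : 0 <= S by rewrite sumr_ge0.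
exists (1 + S)^-1 => [|x]; first by rewrite invr_gt0 ltr_pwDl.
have [ax0|ax0] := eqVneq (a x) 0; first by rewrite ab0 // normr0 mulr0.
rewrite mulrC ler_pdivrMr ?ltr_pwDl // mulrC -ler_pdivrMr; last first.
  by rewrite lt0r ax0 a_ge0.
have : `|b x| / a x <= S by rewrite /S (bigD1 x) //= lerDl sumr_ge0.
lra.
Qed.

Section Perturbation.
Variable R : realType.
Implicit Types (f m : R) (pi : R -> R) (g h : int -> R) (F a b i j k : int).

(** The defects of [g] and [h] are periodic in both variables, so [finite_margin]
    gives a single [e] for which [g + e h] and [g - e h] are both subadditive;
    their interpolations are valid, and [interp M g] is their mean. *)
Theorem grid_perturbation_not_extreme f (M : nat) F g h : (0 < M)%N ->
    f = F%:~R / M%:R ->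
    g 0 = 0 -> g F = 1 -> subadditive g -> (forall k, g (k + M) = g k) ->
    h 0 = 0 -> h F = 0 -> (forall k, h (k + M) = h k) ->
    (forall i j, g (i + j) = g i + g j -> h (i + j) = h i + h j) ->
    (exists k, h k != 0) ->
  ~ extreme f (interp M g).
Proof.
move=> M0 fE g0 gF gsub gM h0 hF hM gh [k hk] [_ ext].
pose D (F : int -> R) i j := F i + F j - F (i + j).
have Dmod (F1 : int -> R) i j : (forall k, F1 (k + M) = F1 k) ->
    D F1 (i %% M)%Z (j %% M)%Z = D F1 i j.
  move=> F1M; rewrite /D !(periodic_modz F1M).
  by rewrite -(periodic_modz F1M (_ + _)) modzDm (periodic_modz F1M).
have [|p|e e0 eP] := @finite_margin R ('I_M * 'I_M)%type
    (fun p => D g p.1 p.2) (fun p => D h p.1 p.2).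
- by move=> p; rewrite subr_ge0.
- by move/eqP; rewrite subr_eq0 => /eqP/esym/gh hE; rewrite /D hE subrr.
have margin i j : e * `|D h i j| <= D g i j.
  have ltM l : (`|(l %% M)%Z| < M)%N by have := @ltz_pmod l M; lia.
  have absM l : `|(l %% M)%Z|%N = (l %% M)%Z :> int.
    by rewrite gez0_abs // modz_ge0 // -lt0n.
  have := eP (Ordinal (ltM i), Ordinal (ltM j)).
  by rewrite /= !absM !Dmod.
have pert c : `|c| = e -> valid f (interp M (fun k => g k + c * h k)).
  move=> ce; apply: (interp_valid M0 fE).
  - by rewrite g0 h0 mulr0 addr0.
  - by rewrite gF hF mulr0 addr0.
  - move=> i j; have := margin i j; rewrite -ce -normrM /D.
    by have := ler_norm (- (c * D h i j)); rewrite normrN /D; lra.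
  - by move=> l; rewrite gM hM.
have [||x|/(congr1 (fun P : R -> R => P (k%:~R / M%:R))) + _] := ext _ _ (pert e _) (pert (- e) _).
- by rewrite gtr0_norm.
- by rewrite normrN gtr0_norm.
- by rewrite /interp; field.
rewrite !(interp_grid M0) => /eqP; rewrite -subr_eq0 opprD addrA subrr add0r oppr_eq0.
by rewrite mulf_eq0 (negbTE hk) gt_eqF.
Qed.

Lemma mod3_cases k : exists a, [\/ k = 3 * a, k = 3 * a + 1 | k = 3 * a + 2].
Proof.
exists (k %/ 3)%Z; have := divz_eq k 3.
have := @modz_ge0 k 3 isT; have := @ltz_pmod k 3 isT.
move: (k %/ 3)%Z (k %% 3)%Z => a r r3 r0 ->.
have [-> | [-> | ->]] : r = 0 \/ r = 1 \/ r = 2 by lia.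
- by constructor 1; lia.
- by constructor 2; lia.
- by constructor 3; lia.
Qed.

(** Here [f] and the breakpoints of [pi] lie on the grid of step 1/N, with grid
    values [G]; the perturbation lives on the grid of step 1/(3N), with grid
    values [g]. Three subdivisions of a cell are the fewest that carry a nonzero
    function odd about the midpoint and vanishing at both ends. *)
Section Flat.
Variables (f m : R) (N : nat) (F : int) (pi : R -> R).
Let G k := pi (k%:~R / N%:R).
Let g k := pi (k%:~R / (3 * N)%:R).

Definition flat_cell k : bool := G k == G (k + 1).

(** The values 0, 1, -1 at the three fine grid points of each flat cell. *)
Definition flat_wave k : R :=
  if flat_cell (k %/ 3)%Z then ((k %% 3)%Z == 1)%:R - ((k %% 3)%Z == 2)%:R else 0.

Hypotheses (N_gt0 : (0 < N)%N) (fE : f = F%:~R / N%:R).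
Hypotheses (pi1 : forall x, pi (x + 1) = pi x) (pi0 : pi 0 = 0).
Hypothesis pi_sym : forall x, pi x + pi (f - x) = 1.
Hypothesis pi_affine : grid_affine N pi.
(* The sum of two heights of flat cells is then never the height of a third. *)
Hypothesis flat_height : forall k, flat_cell k -> m <= G k < 2 * m.

Let N0 : N%:R != 0 :> R. Proof. by rewrite pnatr_eq0 -lt0n. Qed.

Lemma fine_gridE a (r : R) : 0 <= r <= 3 ->
  pi ((3 * a%:~R + r) / (3 * N)%:R) = (1 - r / 3) * G a + r / 3 * G (a + 1).
Proof.
move=> r3; rewrite -pi_affine; last by lra.
by congr pi; rewrite natrM; field.
Qed.

Lemma fine_grid0 a : g (3 * a) = G a.
Proof.
by rewrite /g intrM -[3 * _]addr0 fine_gridE ?lexx ?ler0n //; field.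
Qed.

Lemma fine_grid1 a : g (3 * a + 1) = 2 / 3 * G a + 1 / 3 * G (a + 1).
Proof. by rewrite /g intrD intrM fine_gridE; [field|lra]. Qed.

Lemma fine_grid2 a : g (3 * a + 2) = 1 / 3 * G a + 2 / 3 * G (a + 1).
Proof. by rewrite /g intrD intrM fine_gridE; [field|lra]. Qed.

Lemma grid_affine_refine : grid_affine (3 * N) pi.
Proof.
move=> k t /andP[t0 t1]; rewrite -/(g k) -/(g (k + 1)).
have [a [-> | -> | ->]] := mod3_cases k.
- rewrite fine_grid0 fine_grid1 intrM fine_gridE; last lra.
  by field.
- rewrite fine_grid1 -addrA fine_grid2 intrD intrM -addrA fine_gridE; last lra.
  by field.
- rewrite fine_grid2 (_ : 3 * a + 2 + 1 = 3 * (a + 1)); last lia.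
  rewrite fine_grid0 intrD intrM -addrA fine_gridE; last lra.
  by field.
Qed.

Lemma flat_wave0 a : flat_wave (3 * a) = 0.
Proof. by rewrite /flat_wave modzMr subrr if_same. Qed.

Lemma flat_wave1 a : flat_wave (3 * a + 1) = (flat_cell a)%:R.
Proof.
rewrite /flat_wave mulrC divzMDl // modzMDl addr0 subr0.
by case: (flat_cell a).
Qed.

Lemma flat_wave2 a : flat_wave (3 * a + 2) = - (flat_cell a)%:R.
Proof.
rewrite /flat_wave mulrC divzMDl // modzMDl addr0 sub0r.
by case: (flat_cell a); rewrite ?oppr0.
Qed.

Lemma eq_flat a b : G (a + 1) - G a = G (b + 1) - G b ->
  flat_cell a = flat_cell b.
Proof. by move=> e; rewrite /flat_cell eq_sym -subr_eq0 e subr_eq0 eq_sym. Qed.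

(** With [i = 3 a + r] and [j = 3 b + s], the value of [g i + g j - g (i + j)]
    is a convex combination, with positive weights, of the nonnegative defects
    of [G] at the vertices of the face of the coarse subdivision that contains
    the point. If it is 0, these defects are all 0, and comparing them gives
    equalities between the slopes of [G] on the cells [a], [b] and the cell of
    [i + j]. *)
Lemma flat_wave_additive : subadditive pi ->
  forall i j, g (i + j) = g i + g j ->
    flat_wave (i + j) = flat_wave i + flat_wave j.
Proof.
move=> pisub i j.
have Gsub a b : G (a + b) <= G a + G b.
  by rewrite /G intrD mulrDl pisub.
have [a ia] := mod3_cases i; have [b jb] := mod3_cases j.
have G00 := Gsub a b.
have G10 : G (a + b + 1) <= G (a + 1) + G b by rewrite addrAC.
have G01 : G (a + b + 1) <= G a + G (b + 1) by rewrite -addrA.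
have G11 : G (a + b + 1 + 1) <= G (a + 1) + G (b + 1).
  by rewrite -addrA addrACA.
have noflat : flat_cell a -> flat_cell b -> G (a + b) = G a + G b ->
    flat_cell (a + b) -> False.
  by move=> /flat_height ha /flat_height hb e /flat_height; rewrite e; lra.
have noflatS : flat_cell a -> flat_cell b -> G (a + b + 1) = G a + G b ->
    flat_cell (a + b + 1) -> False.
  by move=> /flat_height ha /flat_height hb e /flat_height; rewrite e; lra.
(* The point is a vertex or on an edge when one of the remainders [r], [s] is 0
   or [r + s = 3], and in the interior of a triangle when [r = s = 1] or
   [r = s = 2]. *)
case: ia jb => -> [] ->.
- by rewrite -mulrDr !flat_wave0 addr0.
- rewrite addrA -mulrDr !fine_grid1 !fine_grid0 !flat_wave1 flat_wave0 add0r.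
  by move=> e; rewrite (@eq_flat (a + b) b) //; lra.
- rewrite addrA -mulrDr !fine_grid2 !fine_grid0 !flat_wave2 flat_wave0 add0r.
  by move=> e; rewrite (@eq_flat (a + b) b) //; lra.
- rewrite addrAC -mulrDr !fine_grid1 !fine_grid0 !flat_wave1 flat_wave0 addr0.
  by move=> e; rewrite (@eq_flat (a + b) a) //; lra.
- rewrite (_ : 3 * a + 1 + _ = 3 * (a + b) + 2); last lia.
  rewrite fine_grid2 !fine_grid1 flat_wave2 !flat_wave1 => e.
  have fa : flat_cell a = flat_cell b by apply: eq_flat; lra.
  have fab : flat_cell (a + b) = flat_cell b by apply: eq_flat; lra.
  rewrite fab fa; have [fb|_] := boolP (flat_cell b); last by rewrite oppr0 addr0.
  by case: noflat; rewrite ?fab ?fa //; lra.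
- rewrite (_ : 3 * a + 1 + _ = 3 * (a + b + 1)); last lia.
  rewrite fine_grid0 fine_grid1 fine_grid2 flat_wave0 flat_wave1 flat_wave2 => e.
  by rewrite (@eq_flat a b) ?subrr //; lra.
- rewrite addrAC -mulrDr !fine_grid2 !fine_grid0 !flat_wave2 flat_wave0 addr0.
  by move=> e; rewrite (@eq_flat (a + b) a) //; lra.
- rewrite (_ : 3 * a + 2 + _ = 3 * (a + b + 1)); last lia.
  rewrite fine_grid0 fine_grid1 fine_grid2 flat_wave0 flat_wave1 flat_wave2 => e.
  by rewrite (@eq_flat a b) ?addNr //; lra.
- rewrite (_ : 3 * a + 2 + _ = 3 * (a + b + 1) + 1); last lia.
  rewrite !fine_grid2 !fine_grid1 !flat_wave2 !flat_wave1 => e.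
  have fa : flat_cell a = flat_cell b by apply: eq_flat; lra.
  have fab : flat_cell (a + b + 1) = flat_cell b by apply: eq_flat; lra.
  rewrite fab fa; have [fb|_] := boolP (flat_cell b); last by rewrite oppr0 addr0.
  have /eqP aE : flat_cell a by rewrite fa.
  by case: noflatS; rewrite ?fab ?fa //; lra.
Qed.

(** The grid perturbation by [flat_wave]. Subadditivity of [pi] is taken from the
    validity that extremality includes. *)
Theorem flat_cells_not_extreme : (exists k, flat_cell k) -> ~ extreme f pi.
Proof.
move=> [k fk] ext; have [piv _] := ext.
have pisub := valid_symmetric_subadditive piv pi_sym.
have N3 : (0 < 3 * N)%N by rewrite muln_gt0.
move: ext; have -> : pi = interp (3 * N) g.
  by apply/funext => x; exact: (grid_affine_interp N3 grid_affine_refine x).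
have pif : pi f = 1 by rewrite -(pi_sym 0) pi0 add0r subr0.
have flatN a : flat_cell (a + N) = flat_cell a.
  have GN b : G (b + N) = G b by rewrite /G intrD mulrDl divff ?pi1.
  by rewrite /flat_cell addrAC !GN.
apply: (@grid_perturbation_not_extreme f (3 * N) (3 * F) g flat_wave) => //.
- by rewrite fE natrM intrM; field.
- by have := fine_grid0 0; rewrite mulr0 => ->; rewrite /G mul0r.
- by rewrite fine_grid0 /G -fE.
- by move=> i j; rewrite /g intrD mulrDl pisub.
- move=> i; rewrite /g intrD mulrDl divff ?pi1 //.
  by rewrite pnatr_eq0 -lt0n.
- by have := flat_wave0 0; rewrite mulr0.
- by rewrite flat_wave0.
- move=> i; rewrite PoszM; have [a [-> | -> | ->]] := mod3_cases i.
  + by rewrite -mulrDr !flat_wave0.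
  + by rewrite addrAC -mulrDr !flat_wave1 flatN.
  + by rewrite addrAC -mulrDr !flat_wave2 flatN.
- exact: flat_wave_additive.
- by exists (3 * k + 1); rewrite flat_wave1 fk oner_eq0.
Qed.

End Flat.
End Perturbation.

(** * Piecewise linear functions given by lengths and slopes *)

Section PiecewiseLinear.
Variable R : realType.
Implicit Types (l : seq (R * R)) (x t u c f : R) (N k : nat).

Definition total_length l : R := \sum_(p <- l) p.1.
Definition rise l : R := \sum_(p <- l) p.1 * p.2.
Definition nonneg_lengths l : bool := all (fun p : R * R => 0 <= p.1) l.

Lemma total_length_cat l1 l2 :
  total_length (l1 ++ l2) = total_length l1 + total_length l2.
Proof. exact: big_cat. Qed.

Lemma rise_cat l1 l2 : rise (l1 ++ l2) = rise l1 + rise l2.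
Proof. exact: big_cat. Qed.

Lemma total_length_ge0 l : nonneg_lengths l -> 0 <= total_length l.
Proof. by move=> /allP l0; rewrite /total_length big_seq sumr_ge0. Qed.

Lemma pwl0 l : nonneg_lengths l -> pwl l 0 = 0.
Proof. by case: l => //= -[n c] l /= /andP[-> _]; rewrite mulr0. Qed.

Lemma pwl_cons_ge n c l x : nonneg_lengths l -> n <= x ->
  pwl ((n, c) :: l) x = c * n + pwl l (x - n).
Proof.
move=> l0 nx /=; case: ifP => // xn.
have -> : x = n by apply/le_anti; rewrite xn nx.
by rewrite subrr pwl0 // addr0.
Qed.

Lemma pwl_cat_le l1 l2 x : nonneg_lengths l1 -> nonneg_lengths l2 ->
  0 <= x <= total_length l1 -> pwl (l1 ++ l2) x = pwl l1 x.
Proof.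
move=> + l20; elim: l1 x => [|[n c] l1 IHl1] x /=.
  by rewrite /total_length big_nil => _ /le_anti <-; rewrite pwl0.
rewrite /total_length big_cons /= => /andP[n0 l10] /andP[x0 xl].
case: leP => // nx; rewrite IHl1 // /total_length; lra.
Qed.

Lemma pwl_cat_ge l1 l2 u : nonneg_lengths l1 -> nonneg_lengths l2 -> 0 <= u ->
  pwl (l1 ++ l2) (total_length l1 + u) = rise l1 + pwl l2 u.
Proof.
move=> + l20 u0; elim: l1 => [|[n c] l1 IHl1] /=.
  by rewrite /total_length /rise !big_nil !add0r.
move=> /andP[n0 l10]; rewrite -/(pwl ((n, c) :: (l1 ++ l2)) _).
rewrite pwl_cons_ge; last 2 first.
- by rewrite /nonneg_lengths all_cat; apply/andP.
- by rewrite /total_length big_cons /= -addrA lerDl addr_ge0 // total_length_ge0.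
have -> : total_length ((n, c) :: l1) + u - n = total_length l1 + u.
  by rewrite /total_length big_cons /=; ring.
by rewrite IHl1 // /rise big_cons /= [c * n]mulrC addrA.
Qed.

Lemma pwl_total_length l : nonneg_lengths l -> pwl l (total_length l) = rise l.
Proof.
by move=> l0; have := pwl_cat_ge (l2 := [::]) l0 isT (lexx 0);
  rewrite cats0 !addr0.
Qed.

(** Reading the pieces backwards is the point reflection of the graph. *)
Lemma pwl_rev l x : nonneg_lengths l -> 0 <= x <= total_length l ->
  pwl l x + pwl (rev l) (total_length l - x) = rise l.
Proof.
have total_length_rev l1 : total_length (rev l1) = total_length l1.
  by apply: perm_big; rewrite perm_rev.
have rise_rev l1 : rise (rev l1) = rise l1.
  by apply: perm_big; rewrite perm_rev.
elim: l x => [|[n c] l IHl] x /=; first by rewrite /rise big_nil addr0.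
move=> /andP[n0 l0] /andP[x0 xl].
have r0 : nonneg_lengths (rev l) by rewrite /nonneg_lengths all_rev.
have nc0 : nonneg_lengths [:: (n, c)] by rewrite /= n0.
rewrite rev_cons -cats1 /rise big_cons /=; case: leP => nx.
  have -> : total_length ((n, c) :: l) - x = total_length (rev l) + (n - x).
    by rewrite total_length_rev /total_length big_cons /=; ring.
  rewrite pwl_cat_ge ?subr_ge0 //= rise_rev gerDl oppr_le0 x0 /rise; ring.
have -> : total_length ((n, c) :: l) - x = total_length l - (x - n).
  by rewrite /total_length big_cons /=; ring.
have xnl : 0 <= x - n <= total_length l by move: xl; rewrite /total_length big_cons /=; lra.
rewrite pwl_cat_le //; first by rewrite -addrA IHl // [c * n]mulrC.
by rewrite total_length_rev; lra.
Qed.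

Definition grid_lengths N l : bool :=
  all (fun p : R * R => p.1 * N%:R \is a Num.nat) l.

Lemma grid_nonneg_lengths N l : (0 < N)%N -> grid_lengths N l ->
  nonneg_lengths l.
Proof.
move=> N0 /allP lN; apply/allP => p /lN/natr_ge0.
by rewrite pmulr_lge0 // ltr0n.
Qed.

Section Grid.
Variable N : nat.
Hypothesis N_gt0 : (0 < N)%N.

Let N0 : N%:R != 0 :> R. Proof. by rewrite pnatr_eq0 -lt0n. Qed.
Let NV0 : 0 < N%:R^-1 :> R. Proof. by rewrite invr_gt0 ltr0n. Qed.

(** The inductive step for statements about grid cells: a piece never ends inside
    a cell, so the cell [k/N, (k+1)/N] lies in the first piece or after it. *)
Lemma pwl_grid_cons n c l k : grid_lengths N ((n, c) :: l) ->
  (forall t, 0 <= t <= 1 ->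
     pwl ((n, c) :: l) ((k%:R + t) / N%:R) = c * ((k%:R + t) / N%:R)) /\
     k.+1%:R / N%:R <= n \/
  exists j : nat, n = (k - j)%N%:R / N%:R /\ (j <= k)%N /\
    forall t, 0 <= t <= 1 -> pwl ((n, c) :: l) ((k%:R + t) / N%:R) =
      c * n + pwl l ((j%:R + t) / N%:R).
Proof.
move=> /= /andP[/natrP[a nE] lN].
have l0 := grid_nonneg_lengths N_gt0 lN.
have {}nE : n = a%:R / N%:R by rewrite -nE mulfK.
have [ka|ak] := ltnP k a.
  left; split=> [t /andP[t0 t1]|]; last by rewrite nE ler_pM2r // ler_nat.
  rewrite ifT // nE ler_pM2r //.
  by apply: (@le_trans _ _ k.+1%:R); [rewrite -natr1 lerD2l|rewrite ler_nat].
right; exists (k - a)%N; split; first by rewrite subKn.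
split=> [|t /andP[t0 t1]]; first exact: leq_subr.
rewrite -/(pwl ((n, c) :: l) _) pwl_cons_ge //.
  by rewrite nE natrB //; congr (_ + pwl l _); field.
rewrite nE ler_pM2r // (@le_trans _ _ k%:R) ?ler_nat // lerDl //.
Qed.

Lemma pwl_grid_affine l k t : grid_lengths N l -> 0 <= t <= 1 ->
  pwl l ((k%:R + t) / N%:R) =
    (1 - t) * pwl l (k%:R / N%:R) + t * pwl l (k.+1%:R / N%:R).
Proof.
move=> + t01; elim: l k => [|[n c] l IHl] k lN.
  by rewrite /= !mulr0 addr0.
have l01 : 0 <= (0 : R) <= 1 by rewrite lexx ler01.
have l11 : 0 <= (1 : R) <= 1 by rewrite lexx ler01.
rewrite -natr1 -[X in (1 - t) * pwl _ (X / _)]addr0.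
case: (pwl_grid_cons k lN) => [[cell _]|[j [_ [_ cell]]]]; rewrite !cell //.
  by field.
rewrite addr0 IHl ?natr1; last by case/andP: lN.
ring.
Qed.

Fixpoint flat_heights (h : R) l : seq R :=
  if l is (n, c) :: l' then
    (if c == 0 then cons h else id) (flat_heights (h + c * n) l')
  else [::].

Lemma pwl_flat_height h l k : grid_lengths N l ->
    k.+1%:R / N%:R <= total_length l ->
    pwl l (k%:R / N%:R) = pwl l (k.+1%:R / N%:R) ->
  h + pwl l (k%:R / N%:R) \in flat_heights h l.
Proof.
elim: l h k => [|[n c] l IHl] h k lN.
  by rewrite /total_length big_nil leNgt mulr_gt0 ?ltr0n.
have l01 : 0 <= (0 : R) <= 1 by rewrite lexx ler01.
have l11 : 0 <= (1 : R) <= 1 by rewrite lexx ler01.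
have lN' : grid_lengths N l by case/andP: lN.
rewrite -[X in pwl _ (X / _)]addr0 -natr1 /total_length big_cons.
case: (pwl_grid_cons k lN) => [[cell _]|[j [nE [jk cell]]]]; rewrite !cell //.
  move=> _ /eqP; rewrite -subr_eq0 -mulrBr -mulrBl mulf_eq0 mulf_eq0.
  rewrite (gt_eqF NV0) orbF addr0 opprD addNKr oppr_eq0 oner_eq0 orbF /=.
  by move=> /eqP->; rewrite eqxx !mul0r addr0 mem_head.
rewrite addr0 !natr1 => kl /addrI e.
suff: (h + c * n) + pwl l (j%:R / N%:R) \in flat_heights (h + c * n) l.
  by rewrite -addrA /=; case: eqP => // _; rewrite inE orbC => ->.
apply: IHl => //; move: kl; rewrite nE natrB //= -lerBlDl.
by congr (_ <= _); rewrite -natr1 -[j.+1%:R]natr1; field.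
Qed.

End Grid.

(** Since the function returns to 0 after a total length of 1, composing it with
    the fractional part gives a continuous periodic function. *)
Section Periodic.
Variable l : seq (R * R).
Let per x := pwl l (x - (Num.floor x)%:~R).
Hypotheses (l0 : nonneg_lengths l) (l1 : total_length l = 1) (lr : rise l = 0).

Lemma periodize_add1 x : per (x + 1) = per x.
Proof.
rewrite /per floorDrz // floor1 intrD opprD addrACA.
by rewrite -[1%:~R]/1 subrr addr0.
Qed.

Lemma periodize_addz x (z : int) : per (x + z%:~R) = per x.
Proof.
by rewrite /per floorDrz // intrKfloor intrD opprD addrACA subrr addr0.
Qed.

Lemma periodizeE x : 0 <= x <= 1 -> per x = pwl l x.
Proof.
rewrite le_eqVlt => /andP[x0]; rewrite le_eqVlt => /orP[/eqP->|x1].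
  rewrite /per floor1 subrr pwl0 //; have := pwl_total_length l0.
  by rewrite l1 lr.
rewrite /per (floor_def (m := 0)) ?subr0 // add0r x1 andbT.
by rewrite le_eqVlt.
Qed.

Variable N : nat.
Hypotheses (N_gt0 : (0 < N)%N) (lN : grid_lengths N l).

Let NV0 : 0 < N%:R^-1 :> R. Proof. by rewrite invr_gt0 ltr0n. Qed.

Lemma periodize_cell (k : int) : exists2 j : nat, (j < N)%N &
  forall t, 0 <= t <= 1 -> per ((k%:~R + t) / N%:R) = pwl l ((j%:R + t) / N%:R).
Proof.
have kN : (k %% N)%Z = `|(k %% N)%Z|%N :> int.
  by rewrite gez0_abs // modz_ge0 // -lt0n.
exists `|(k %% N)%Z|%N; first by rewrite -ltz_nat -kN ltz_pmod.
have jN : (`|(k %% N)%Z| < N)%N by rewrite -ltz_nat -kN ltz_pmod.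
move=> t /andP[t0 t1].
rewrite {1}(divz_eq k N) kN; move: `|_|%N jN => j jN.
have -> : (((k %/ N)%Z * N + j)%:~R + t) / N%:R =
    (j%:R + t) / N%:R + (k %/ N)%Z%:~R :> R.
  rewrite intrD intrM -!pmulrn; field.
  by rewrite pnatr_eq0 -lt0n.
rewrite periodize_addz periodizeE // mulr_ge0 ?addr_ge0 ?(ltW NV0) //=.
rewrite ler_pdivrMr ?ltr0n // mul1r.
apply: (@le_trans _ _ j.+1%:R); last by rewrite ler_nat.
by rewrite -natr1 lerD2l.
Qed.

Lemma periodize_grid_affine : grid_affine N per.
Proof.
move=> k t t01; have [j _ cell] := periodize_cell k.
have l01 : 0 <= (0 : R) <= 1 by rewrite lexx ler01.
have l11 : 0 <= (1 : R) <= 1 by rewrite lexx ler01.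
rewrite intrD -[X in (1 - t) * per (X / _)]addr0 !cell //.
by rewrite addr0 natr1 pwl_grid_affine.
Qed.

Lemma periodize_flat_height (k : int) : flat_cell N per k ->
  per (k%:~R / N%:R) \in flat_heights 0 l.
Proof.
have [j jN cell] := periodize_cell k.
have l01 : 0 <= (0 : R) <= 1 by rewrite lexx ler01.
have l11 : 0 <= (1 : R) <= 1 by rewrite lexx ler01.
rewrite /flat_cell intrD -[X in per (X / _)]addr0 !cell //.
rewrite addr0 natr1 => /eqP e; rewrite -[pwl _ _]add0r.
apply: pwl_flat_height N_gt0 _ _ _ lN _ e.
by rewrite l1 ler_pdivrMr ?ltr0n // mul1r ler_nat.
Qed.

End Periodic.

(** On [0, f] this is the reflection property of a palindrome; on [f, 1] both
    [x] and [1 + f - x] lie in the last piece, where the function is affine with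
    values 1 and 0 at the ends. *)
Lemma palindrome_symmetric (b : seq (R * R)) f c :
    let per x := pwl (rcons b (1 - f, c)) (x - (Num.floor x)%:~R) in
    0 <= f <= 1 -> nonneg_lengths b -> rev b = b ->
    total_length b = f -> rise b = 1 -> c * (1 - f) = - 1 ->
  forall x, per x + per (f - x) = 1.
Proof.
set l := rcons b _; move=> per /andP[f0 f1] b0 brev bf b1 cf x.
have last0 : nonneg_lengths [:: (1 - f, c)] by rewrite /= subr_ge0 f1.
have l0 : nonneg_lengths l by rewrite /l /nonneg_lengths all_rcons /= subr_ge0 f1.
have lE : l = b ++ [:: (1 - f, c)] by rewrite /l cats1.
have l1 : total_length l = 1 by rewrite lE total_length_cat bf /total_length big_seq1 /= addrC subrK.
have lr : rise l = 0 by rewrite lE rise_cat b1 /rise big_seq1 /= mulrC cf subrr.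
have perE u : 0 <= u <= 1 -> per u = pwl l u by exact: periodizeE.
have perD u (z : int) : per (u + z%:~R) = per u by exact: periodize_addz.
have [y [y0 y1 ->]] : exists y, [/\ 0 <= y, y < 1 & x = y + (Num.floor x)%:~R].
  exists (x - (Num.floor x)%:~R); rewrite subrK.
  by have := floor_itv x; rewrite intrD => fx; split=> //; lra.
move: (Num.floor x) => z; rewrite perD opprD addrA -intrN perD.
have tail u : 0 <= u <= 1 - f -> pwl l (f + u) = 1 + c * u.
  by move=> /andP[u0 u1]; have := pwl_cat_ge b0 last0 u0; rewrite bf -lE b1 /= u1.
have [yf|fy] := leP y f.
  rewrite !perE; [|lra|lra].
  rewrite lE !pwl_cat_le ?bf ?y0 //; last lra.
  by rewrite -{2}brev -[X in X - y]bf pwl_rev ?bf ?y0.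
rewrite -(perD (f - y) 1) !perE; [|rewrite -[1%:~R]/1; lra|lra].
rewrite -{1}[y](addrNK f) addrC.
have -> : f - y + 1%:~R = f + (1 - y) by rewrite -[1%:~R]/1; ring.
rewrite [y - f + f]addrC !tail; lra.
Qed.

End PiecewiseLinear.

(** * The parameters of the construction *)

Section Example.
Variable R : realType.

Definition example_lengths : lengths R :=
  Lengths (2 / 15) (1 / 60) (7 / 60) (1 / 30) (1 / 20) (1 / 10)
          (1 / 20) (1 / 30) (7 / 60) (1 / 60) (2 / 15).

Lemma slope1_example : slope1 (4 / 5) (3 / 5) (1 / 10) (1 / 10) = 5 / 2 :> R.
Proof. by rewrite /slope1 /slope2 /slope3; field. Qed.

Lemma slope3_example : slope3 (4 / 5) = - 5 :> R.
Proof. by rewrite /slope3; field. Qed.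

(** All requirements except positivity are linear equations in the eleven
    lengths, and the resulting system is nonsingular. *)
Lemma step1_example (d : lengths R) :
  step1 (4 / 5) (3 / 5) (1 / 10) (1 / 10) (15 / 100) d <-> d = example_lengths.
Proof.
split=> [[] | ->].
  case: d => l11 l31 l12 l32 l21 l13 l22 l33 l14 l34 l15 /=.
  rewrite slope1_example slope3_example /slope2 => _ _ _ _ _ _ e1 e2 e3.
  move=> [s1 s1'] s2 [s3 s3'] bl br pr; congr Lengths; lra.
split; rewrite /= ?slope1_example ?slope3_example /slope2; try lra.
all: split; lra.
Qed.

(** The condition [c1 x + c3 y = 0] reads [x = 2 y] for the slopes 5/2 and -5,
    so the inserted pieces have lengths [2 * y1], [y1], [2 * y2], [y2]. All
    other lengths are multiples of 1/60, up to subtracting these. *)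
Lemma example_not_extreme (y1 y2 : R) (q : nat) : (0 < q)%N ->
    0 < y1 -> 0 < y2 -> y1 + y2 < 1 / 120 ->
    y1 * (60 * q)%:R \is a Num.int -> y2 * (60 * q)%:R \is a Num.int ->
  ~ extreme (4 / 5) (fun r => pwl
      (pieces (4 / 5) (5 / 2) 0 (- 5) example_lengths (2 * y1) y1 (2 * y2) y2)
      (r - (Num.floor r)%:~R)).
Proof.
move=> q0 y1_gt0 y2_gt0 y12 y1N y2N.
set l := pieces _ _ _ _ _ _ _ _ _.
have N0 : (0 < 60 * q)%N by rewrite muln_gt0.
have lN : grid_lengths (60 * q) l.
  have nat_len (v : R) : v * (60 * q)%:R \is a Num.int -> 0 <= v ->
      v * (60 * q)%:R \is a Num.nat.
    by move=> vN v0; rewrite natrEint vN mulr_ge0.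
  have int_len (n : nat) (v : R) : v = n%:R / 60 -> v * (60 * q)%:R \is a Num.int.
    move=> ->; rewrite natrM mulrA divfK ?pnatr_eq0 // -natrM.
    exact: natr_int.
  have yN (y : R) : 0 < y -> y * (60 * q)%:R \is a Num.int ->
      y * (60 * q)%:R \is a Num.nat /\ 2 * y * (60 * q)%:R \is a Num.nat.
    move=> y_gt0 yint; split; apply: nat_len => //; try lra.
    by rewrite -mulrA rpredM // natr_int.
  have [] := yN _ y1_gt0 y1N; have [] := yN _ y2_gt0 y2N => n2 n2' n1 n1'.
  have n11 : 2 / 15 * (60 * q)%:R \is a @Num.nat R.
    by apply: nat_len; [apply: (int_len 8); field | lra].
  have n31 : 1 / 60 * (60 * q)%:R \is a @Num.nat R.
    by apply: nat_len; [apply: (int_len 1); field | lra].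
  have n21 : 1 / 20 * (60 * q)%:R \is a @Num.nat R.
    by apply: nat_len; [apply: (int_len 3); field | lra].
  have n13 : 1 / 10 * (60 * q)%:R \is a @Num.nat R.
    by apply: nat_len; [apply: (int_len 6); field | lra].
  have ne : (1 - 4 / 5) * (60 * q)%:R \is a @Num.nat R.
    by apply: nat_len; [apply: (int_len 12); field | lra].
  have n12 : (7 / 60 - 2 * y1 - 2 * y2) * (60 * q)%:R \is a Num.nat.
    apply: nat_len; last lra.
    rewrite !mulrBl !rpredB ?(intr_nat n1') ?(intr_nat n2') //.
    by apply: (int_len 7); field.
  have n32 : (1 / 30 - y1 - y2) * (60 * q)%:R \is a Num.nat.
    apply: nat_len; last lra.
    by rewrite !mulrBl !rpredB //; apply: (int_len 2); field.
  by rewrite /grid_lengths /= n11 n31 n21 n13 ne n12 n32 n1 n1' n2 n2'.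
have l0 := grid_nonneg_lengths N0 lN.
have lE : rcons (take 19 l) (1 - 4 / 5, - 5) = l by [].
have l1 : total_length l = 1 by rewrite /total_length !big_cons big_nil /=; field.
have lr : rise l = 0 by rewrite /rise !big_cons big_nil /=; field.
have heights : flat_heights 0 l = [:: 3 / 8; 5 / 8].
  have c1 : (5 / 2 == 0 :> R) = false by apply/negbTE; lra.
  have c3 : (- 5 == 0 :> R) = false by apply/negbTE; lra.
  rewrite /l /= c1 c3 eqxx /=.
  by congr [:: _; _]; field.
apply: (@flat_cells_not_extreme R (4 / 5) (3 / 8) (60 * q) (48 * q)%N).
- exact: N0.
- rewrite PoszM intrM natrM -!pmulrn; field.
  by rewrite pnatr_eq0 -lt0n.
- exact: periodize_add1.
- by rewrite floor0 subr0 pwl0.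
- rewrite -lE; apply: palindrome_symmetric => //.
  + lra.
  + by move: l0; rewrite -{1}lE /nonneg_lengths all_rcons => /andP[].
  + by rewrite /total_length !big_cons big_nil /=; field.
  + by rewrite /rise !big_cons big_nil /=; field.
  + lra.
- exact: periodize_grid_affine.
- move=> k /(periodize_flat_height l0 l1 lr N0 lN).
  by rewrite heights !inE => /orP[]/eqP->; lra.
- (* The first plateau starts at 3/10 = 18/60, after eight pieces. *)
  exists (18 * q)%N.
  have qR : 0 < q%:R :> R by rewrite ltr0n.
  have kN : (18 * q)%N%:~R / (60 * q)%:R = total_length (take 8 l) + 0 :> R.
    rewrite /total_length !big_cons big_nil /= -pmulrn !natrM; field.
    by rewrite gt_eqF.
  have k1N : (Posz (18 * q)%N + 1)%:~R / (60 * q)%:R =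
      total_length (take 8 l) + (60 * q)%:R^-1 :> R.
    by rewrite intrD mulrDl kN addr0 mul1r.
  have N_inv : 0 < (60 * q)%:R^-1 :> R by rewrite invr_gt0 ltr0n.
  have N_inv_le : (60 * q)%:R^-1 <= 1 / 20 :> R.
    rewrite div1r lef_pV2 ?posrE ?ltr0n // ler_nat; lia.
  have start : total_length (take 8 l) = 3 / 10.
    by rewrite /total_length !big_cons big_nil /=; field.
  have plateau u : 0 <= u <= 1 / 20 ->
      pwl l (total_length (take 8 l) + u) = rise (take 8 l).
    move=> /andP[u0 u1]; move: l0; rewrite -{1 2}(cat_take_drop 8 l).
    rewrite /nonneg_lengths all_cat => /andP[l10 l20].
    by rewrite pwl_cat_ge //= u1 mul0r addr0.
  have on_plateau (x u : R) : x = total_length (take 8 l) + u -> 0 <= u <= 1 / 20 ->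
      pwl l (x - (Num.floor x)%:~R) = rise (take 8 l).
    move=> -> u01; rewrite (periodizeE l0 l1 lr) ?plateau //.
    by rewrite start; lra.
  apply/eqP; apply: etrans (on_plateau _ _ kN _) (esym (on_plateau _ _ k1N _)).
  - lra.
  - lra.
Qed.

Lemma rat_common_grid (x y : rat) : 0 < x -> 0 < y ->
  exists2 q : nat, (0 < q)%N &
    (ratr x : R) * q%:R \is a Num.int /\ (ratr y : R) * q%:R \is a Num.int.
Proof.
move=> x0 y0.
have den (z : rat) : (ratr z : R) * `|denq z|%:R = (numq z)%:~R.
  by rewrite pmulrn absz_denq /ratr divfK // intr_eq0 denq_eq0.
exists (`|denq x| * `|denq y|)%N.
  by rewrite muln_gt0 !absz_gt0 !denq_eq0.
by split; rewrite natrM; [rewrite mulrA|rewrite mulrCA]; rewrite den rpredM // ?intr_int ?natr_int.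
Qed.

End Example.

Theorem theorem5p4 (R : realType) (f d1 d2 d3 a : R)
    (hf : f = 4 / 5) (hd1 : d1 = 3 / 5) (hd3 : d3 = 1 / 10)
    (hd : d1 + d2 + d3 = f) (ha : a = 15 / 100) :
  (exists! d : lengths R, step1 f d1 d2 d3 a d) /\
  forall d : lengths R, step1 f d1 d2 d3 a d ->
  forall delta1 delta2 : rat, 0 < delta1 -> 0 < delta2 ->
    ratr (delta1 + delta2) < d1_2 d + d2_2 d ->
    ratr (delta1 + delta2) < d2_1 d / 2 ->
  forall x1 y1 x2 y2 : R,
    delta_split (slope1 f d1 d2 d3) (slope3 f) (ratr delta1) x1 y1 ->
    delta_split (slope1 f d1 d2 d3) (slope3 f) (ratr delta2) x2 y2 ->
  ~ extreme f (construction f d1 d2 d3 d x1 y1 x2 y2).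
Proof.
have d2E : d2 = 1 / 10 by lra.
subst f d1 d2 d3 a; split.
  by exists (example_lengths R); split=> [|d]; [|move=> /step1_example ->];
    first exact/step1_example.
move=> d /step1_example-> delta1 delta2 delta1_gt0 delta2_gt0 _ /=.
rewrite rmorphD /= => small x1 y1 x2 y2.
rewrite /construction slope1_example slope3_example /slope2.
move=> [x1y1 rise1] [x2y2 rise2].
have [-> ->] : x1 = 2 * y1 /\ x2 = 2 * y2 by split; lra.
(* [y1] and [y2] are thirds of the given rationals; the factor 60 of the grid
   absorbs the 3. *)
have [q q0 [q1 q2]] := rat_common_grid R delta1_gt0 delta2_gt0.
have y1E : y1 = ratr delta1 / 3 by lra.
have y2E : y2 = ratr delta2 / 3 by lra.
have y1_gt0 : 0 < y1 by rewrite y1E divr_gt0 // ltr0q.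
have y2_gt0 : 0 < y2 by rewrite y2E divr_gt0 // ltr0q.
have third (v : R) : v * q%:R \is a Num.int -> v / 3 * (60 * q)%:R \is a Num.int.
  move=> vq; have -> : v / 3 * (60 * q)%:R = 20%:R * (v * q%:R).
    by rewrite natrM; field.
  by rewrite rpredM // natr_int.
apply: (example_not_extreme q0) => //; first lra.
- by rewrite y1E third.
- by rewrite y2E third.
Qed.
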